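(* Let $K\subseteq\mathbb{R}^n$ be compact, let $T:K\to\mathbb{R}^n$ be a $1$-Lipschitz map (Euclidean norm), and let $r:K\to(0,\infty)$ be continuous. (i) Suppose that $\mathcal{U}(\mu*\gamma_s)\le\mathcal{U}(T_\#\mu*\gamma_s)$ for every $\mu\in\mathcal{P}(K)$, every $s>0$, and every internal energy $\mathcal{U}$ with nondecreasing pressure. Then $$\Big|\bigcup_{x\in K}\mathcal{B}(T(x),r(x))\Big|\le\Big|\bigcup_{x\in K}\mathcal{B}(x,r(x))\Big|.$$ (ii) Suppose that $\mathcal{U}(\mu*\gamma_s)\le\mathcal{U}(T_\#\mu*\gamma_s)$ for every $\mu\in\mathcal{P}(K)$, every $s>0$, and every internal energy $\mathcal{U}$ with nonnegative pressure. Then, for every $0<c<\min_{x\in K}r(x)^2$, $$\Big|\Big(\bigcup_{x\in K}\mathcal{B}\big(T(x),\sqrt{r(x)^2+c}\big)\Big)\setminus\Big(\bigcup_{x\in K}\mathcal{B}\big(T(x),\sqrt{r(x)^2-c}\big)\Big)\Big|\le\Big|\Big(\bigcup_{x\in K}\mathcal{B}\big(x,\sqrt{r(x)^2+c}\big)\Big)\setminus\Big(\bigcup_{x\in K}\mathcal{B}\big(x,\sqrt{r(x)^2-c}\big)\Big)\Big|.$$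
   Context: $\mathcal{B}(x,r)$ is the closed Euclidean ball of radius $r$ centred at $x$ in $\mathbb{R}^n$, and $|\cdot|$ is Lebesgue measure. $\mathcal{P}(K)$ is the set of Borel probability measures on $K$. $\gamma_s(x)=(2\pi s)^{-n/2}e^{-\|x\|_2^2/(2s)}$; $\mu*\gamma_s$ denotes the density $x\mapsto\int\gamma_s(x-y)\,d\mu(y)$ on $\mathbb{R}^n$; $T_\#\mu$ is the push-forward. An energy density is a measurable $U:[0,\infty)\to\mathbb{R}$ with $U(0)=0$; its internal energy is $\mathcal{U}(\rho)=\int_{\mathbb{R}^n}U(\rho(x))\,dx\in[-\infty,+\infty]$ for probability densities $\rho$ for which the integral is defined. $\mathcal{U}$ has nondecreasing pressure if $U$ is convex on $[0,\infty)$; $\mathcal{U}$ has nonnegative pressure if $\rho\mapsto U(\rho)/\rho$ is nondecreasing on $(0,\infty)$. *)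

(* Defs.v *)
From HB Require Import structures.
From mathcomp Require Import all_boot all_order all_algebra.
From mathcomp Require Import all_classical all_reals all_analysis.

Set Implicit Arguments.
Unset Strict Implicit.
Unset Printing Implicit Defensive.

Import Order.TTheory GRing.Theory Num.Theory.
Import numFieldNormedType.Exports.

Local Open Scope classical_set_scope.
Local Open Scope ring_scope.

Section borel.
Context {R : realType}.

(* ['rV[R]_n] carries the sup norm in the library, but its topology is the
   usual one of R^n; hence this is the Borel sigma-algebra of R^n. *)
HB.instance Definition _ (n : nat) :=
  @isMeasurable.Build (sigma_display (@open 'rV[R]_n)) 'rV[R]_n
    <<s @open 'rV[R]_n >> (@sigma_algebra0 _ setT open)
    (@sigma_algebraC _ open) (@sigma_algebra_bigcup _ setT open).

Lemma open_measurable_rV n (U : set 'rV[R]_n) : open U -> measurable U.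
Proof. by move=> oU; exact: sub_sigma_algebra. Qed.

Lemma closed_measurable_rV n (U : set 'rV[R]_n) : closed U -> measurable U.
Proof.
move=> cU; rewrite -(setCK U); apply: measurableC; apply: open_measurable_rV.
by rewrite openC.
Qed.

Lemma continuous_measurable_rV n (f : 'rV[R]_n -> R) :
  continuous f -> measurable_fun setT f.
Proof.
move=> /continuousP cf; apply: (measurability _ (measurable_realfun.RGenOpens.measurableE R)).
move=> _ [_ [a [b ->]] <-]; rewrite setTI; apply: open_measurable_rV.
exact/cf/interval_open.
Qed.

Lemma measurable_fun_coord n (i : 'I_n) :
  measurable_fun setT (fun x : 'rV[R]_n => x 0 i).
Proof. by apply: continuous_measurable_rV; exact: coord_continuous. Qed.

Lemma measurable_fun_rV d (T : measurableType d) n (f : T -> 'rV[R]_n) :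
  (forall i, measurable_fun setT (fun t => f t 0 i)) -> measurable_fun setT f.
Proof.
move=> mf; apply: (@measurability _ _ _ _ setT f open) => // _ [U oU <-]; rewrite setTI.
pose box (q : {ffun 'I_n -> rat} * {ffun 'I_n -> rat}) : set 'rV[R]_n :=
  [set x | forall i, x 0 i \in `]ratr (q.1 i), ratr (q.2 i)[].
have -> : f @^-1` U = \bigcup_(q in [set q | box q `<=` U]) f @^-1` (box q).
  apply/seteqP; split=> [t Uft|t [q /= + qt]]; last exact.
  have : nbhs (f t) U by exact: open_nbhs_nbhs.
  move=> /nbhs_ballP[e /= e0 eU].
  have rex (i : 'I_n) : exists q : rat * rat,
      [/\ ratr q.1 < f t 0 i, f t 0 i < ratr q.2,
          f t 0 i - e < ratr q.1 & ratr q.2 < f t 0 i + e].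
    have [|a] := @rat_in_itvoo R (f t 0 i - e) (f t 0 i).
      by rewrite ltrBlDr ltrDl.
    rewrite in_itv/= => /andP[a1 a2].
    have [|b] := @rat_in_itvoo R (f t 0 i) (f t 0 i + e); first by rewrite ltrDl.
    by rewrite in_itv/= => /andP[b1 b2]; exists (a, b).
  have /choice[g gP] := rex.
  exists ([ffun i => (g i).1], [ffun i => (g i).2]) => /= [x xb|i].
    apply: eU; split => // i j; rewrite (ord1 i).
    have [g1 g2 g3 g4] := gP j.
    have := xb j; rewrite /= !ffunE in_itv/= => /andP[x1 x2].
    rewrite /ball/= ltr_distlC.
    by rewrite (lt_trans g3)//= (lt_trans x2).
  by rewrite !ffunE in_itv/=; have [-> ->] := gP i.
rewrite bigcup_mkcond; apply: countable_bigcupT_measurable.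
  exact: countableP.
move=> q; case: ifPn => // _.
have -> : f @^-1` box q = \bigcap_(i in [set: 'I_n])
    ((fun t => f t 0 i) @^-1` `]ratr (q.1 i), ratr (q.2 i)[).
  by apply/seteqP; split=> [t /= qt i _|t /= qt i]; exact: qt.
apply: fin_bigcap_measurable => // i _.
by rewrite -[X in measurable X]setTI; exact: mf.
Qed.

End borel.

Section lebesgue_step.
Context {R : realType} (n : nat).

Definition consrV (p : measurableTypeR R * 'rV[R]_n) : 'rV[R]_n.+1 :=
  @row_mx R 1 1 n (p.1 : R)%:M p.2.

Lemma consrV0 p : consrV p 0 ord0 = p.1.
Proof.
rewrite /consrV (_ : ord0 = lshift n (ord0 : 'I_1)); last exact/val_inj.
by rewrite (row_mxEl (p.1 : R)%:M p.2) mxE eqxx mulr1n.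
Qed.

Lemma consrVS p i : consrV p 0 (lift ord0 i) = p.2 0 i.
Proof.
rewrite /consrV (_ : lift ord0 i = rshift 1 i); last exact/val_inj.
by rewrite (row_mxEr (p.1 : R)%:M p.2).
Qed.

Lemma measurable_consrV : measurable_fun setT consrV.
Proof.
apply: measurable_fun_rV => i; case: (unliftP ord0 i) => [j|] ->.
  rewrite (_ : (fun t => _) = (fun x : 'rV[R]_n => x 0 j) \o snd).
    by apply: measurableT_comp => //; exact: measurable_fun_coord.
  by apply/funext => p /=; rewrite consrVS.
rewrite (_ : (fun t => _) = fst) //.
by apply/funext => p /=; rewrite consrV0.
Qed.

Let unconsrV (x : 'rV[R]_n.+1) : measurableTypeR R * 'rV[R]_n :=
  (x 0 ord0, \row_i x 0 (lift ord0 i)).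

Let consrVK : cancel consrV unconsrV.
Proof.
move=> [a x]; rewrite /unconsrV consrV0/=; congr (_, _).
by apply/rowP => i; rewrite mxE consrVS.
Qed.

Let measurable_unconsrV : measurable_fun setT unconsrV.
Proof.
apply/measurable_fun_pairP; split; first exact: measurable_fun_coord.
apply: measurable_fun_rV => i.
rewrite (_ : (fun t => _) = (fun x : 'rV[R]_n.+1 => x 0 (lift ord0 i))).
  exact: measurable_fun_coord.
by apply/funext => x /=; rewrite mxE.
Qed.

Variable m : {sigma_finite_measure set 'rV[R]_n -> \bar R}.

Definition lebesgue_step : set 'rV[R]_n.+1 -> \bar R :=
  pushforward (lebesgue_measure \x m)%E consrV.

Let step0 : lebesgue_step set0 = 0%E.
Proof. by rewrite /lebesgue_step /pushforward preimage_set0 measure0. Qed.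

Let step_ge0 A : (0 <= lebesgue_step A)%E.
Proof. by rewrite /lebesgue_step /pushforward; exact: measure_ge0. Qed.

Let step_sigma_additive : semi_sigma_additive lebesgue_step.
Proof.
have mc := measurable_consrV; exact: measure_semi_sigma_additive.
Qed.

HB.instance Definition _ := isMeasure.Build _ _ _ lebesgue_step
  step0 step_ge0 step_sigma_additive.

Let step_sigma_finite : sigma_finite setT lebesgue_step.
Proof.
have /sigma_finiteP[F [FT ndF Ffin]] := sigma_finiteT (@lebesgue_measure R).
have /sigma_finiteP[G [GT ndG Gfin]] := sigma_finiteT m.
exists (fun k => unconsrV @^-1` (F k `*` G k)).
  rewrite -preimage_bigcup; apply/seteqP; split => // x _.
  have [i _ Fi] : (\bigcup_i F i) (unconsrV x).1 by rewrite -FT.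
  have [j _ Gj] : (\bigcup_i G i) (unconsrV x).2 by rewrite -GT.
  exists (maxn i j) => //; split.
  - by move: Fi; exact/subsetPset/ndF/leq_maxl.
  - by move: Gj; exact/subsetPset/ndG/leq_maxr.
move=> k; have [mF Fk] := Ffin k; have [mG Gk] := Gfin k.
have mFG : measurable (F k `*` G k) by exact: measurableX.
split; first by rewrite -[X in measurable X]setTI; exact: measurable_unconsrV.
rewrite /lebesgue_step /pushforward -comp_preimage.
rewrite (_ : unconsrV \o consrV = id); last by apply/funext => p; exact: consrVK.
by rewrite preimage_id product_measure1E// lte_mul_pinfty// ge0_fin_numE.
Qed.

HB.instance Definition _ := Measure_isSigmaFinite.Build _ _ _ lebesgue_step
  step_sigma_finite.

End lebesgue_step.

(* Iterated product of the one-dimensional Lebesgue measure; R^0 is a point of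
   mass 1. *)
Fixpoint lebesgue_rV {R : realType} (n : nat) :
    {sigma_finite_measure set 'rV[R]_n -> \bar R} :=
  match n with
  | 0%N => \d_(0 : 'rV[R]_0)
  | m.+1 => lebesgue_step (lebesgue_rV m)
  end.

Lemma lebesgue_rV_box (R : realType) n (A : 'I_n -> set R) :
  (forall i, measurable (A i)) ->
  lebesgue_rV n [set x : 'rV[R]_n | forall i, A i (x 0 i)] =
  (\prod_(i < n) lebesgue_measure (A i))%E.
Proof.
elim: n A => [|n IH] A mA /=.
  by rewrite big_ord0 diracE mem_set// => -[].
have mB : measurable [set x : 'rV[R]_n | forall i, A (lift ord0 i) (x 0 i)].
  rewrite (_ : mkset _ = \bigcap_(i in [set: 'I_n])
    ((fun x : 'rV[R]_n => x 0 i) @^-1` A (lift ord0 i))); last first.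
    by apply/seteqP; split=> [x Ax i _|x Ax i]; exact: Ax.
  apply: fin_bigcap_measurable => // i _.
  by rewrite -[X in measurable X]setTI; exact: measurable_fun_coord.
rewrite big_ord_recl -IH// -product_measure1E//; last exact: (mA ord0).
rewrite /lebesgue_step /pushforward.
congr ((_ \x _)%E _); apply/seteqP; split=> [p Ap|p [/= A0 AS] i].
  by split => [|i] /=; rewrite -?consrV0 -?consrVS; exact: Ap.
by case: (unliftP ord0 i) => [j|] ->; rewrite ?consrV0 ?consrVS//; exact: AS.
Qed.

Section euclidean.
Context {R : realType} {n : nat}.

Definition enorm (x : 'rV[R]_n) : R := Num.sqrt (\sum_i x 0 i ^+ 2).

Definition eball (x : 'rV[R]_n) (r : R) : set 'rV[R]_n :=
  [set y | enorm (y - x) <= r].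

Definition lipschitz1_on (K : set 'rV[R]_n) (T : 'rV[R]_n -> 'rV[R]_n) :=
  {in K &, forall x y, enorm (T x - T y) <= enorm (x - y)}.

Definition gauss (s : R) (x : 'rV[R]_n) : R :=
  (2 * pi * s) `^ (- (n%:R / 2)) * expR (- (enorm x ^+ 2 / (2 * s))).

(* [fine] only casts to [R]: the integrand is bounded and [nu] finite. *)
Definition gauss_conv (nu : set 'rV[R]_n -> \bar R) (s : R) (x : 'rV[R]_n) : R :=
  fine (\int[nu]_y (gauss s (x - y))%:E).

(* Probability measures on [K] are represented by Borel probability measures
   [mu] on R^n with [mu K = 1], and maps on [K] by total functions; the values
   of [T] off [K] play no role. *)
Definition pushforward_on (K : set 'rV[R]_n) (T : 'rV[R]_n -> 'rV[R]_n)
    (mu : set 'rV[R]_n -> \bar R) : set 'rV[R]_n -> \bar R :=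
  fun A => mu (K `&` T @^-1` A).

End euclidean.

Section energy.
Context {R : realType}.

(* Only the values of [U] on [0, +oo[ matter. *)
Definition energy_density (U : R -> R) :=
  measurable_fun (`[0, +oo[%classic : set R) U /\ U 0 = 0.

Definition internal_energy n (U : R -> R) (rho : 'rV[R]_n -> R) : \bar R :=
  (\int[lebesgue_rV n]_x (U (rho x))%:E)%E.

(* The integral makes sense in [-oo, +oo]: its positive and negative parts are
   not both infinite. *)
Definition energy_defined n (U : R -> R) (rho : 'rV[R]_n -> R) :=
  let f := fun x => (U (rho x))%:E in
  ((\int[lebesgue_rV n]_x f^\+ x < +oo)%E \/
   (\int[lebesgue_rV n]_x f^\- x < +oo)%E).

Definition nondecreasing_pressure (U : R -> R) :=
  @convex_function R R^o `[0, +oo[ U.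

Definition nonnegative_pressure (U : R -> R) :=
  {in `]0, +oo[ &, {homo (fun t => U t / t) : s t / s <= t}}.

(* The energy inequality is only required when both energies are defined. *)
Definition energies_ordered n (K : set 'rV[R]_n) (T : 'rV[R]_n -> 'rV[R]_n)
    (pressure : (R -> R) -> Prop) :=
  forall (mu : probability 'rV[R]_n R) (s : R) (U : R -> R),
  mu K = 1%E -> 0 < s -> energy_density U -> pressure U ->
  energy_defined U (gauss_conv mu s) ->
  energy_defined U (gauss_conv (pushforward_on K T mu) s) ->
  (internal_energy U (gauss_conv mu s) <=
   internal_energy U (gauss_conv (pushforward_on K T mu) s))%E.

End energy.

(* Main.v *)
Require Import Defs.
From mathcomp Require Import all_boot all_order all_algebra.
From mathcomp Require Import all_classical all_reals all_analysis.
From mathcomp Require Import finmap measurable_realfun ring lra.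

Set Implicit Arguments.
Unset Strict Implicit.
Unset Printing Implicit Defensive.

Import Order.TTheory GRing.Theory Num.Theory.
Import numFieldNormedType.Exports.

Local Open Scope classical_set_scope.
Local Open Scope ring_scope.

(* Put D_f(y) = max_(x in K) (r(x)^2 - |y - f(x)|^2) for f = id or f = T: the
   unions of balls are superlevel sets of D_f. If mu gives mass proportional to
   e^(b r(p)^2) to each point p of a fine finite net of K and s = 1/(2b), then
   both mu * gamma_s and T_# mu * gamma_s are, up to a common factor and to
   errors in the exponent that are small compared with b, equal to e^(b D_id)
   and e^(b D_T). Let U(z) = - min(z / A, 1), possibly cut off to 0 above a
   threshold; U is convex without the cut-off and has nonnegative pressure with
   it. With A and the threshold at heights e^(b t) and e^(b u), the energy of
   e^(b D) tends to - |{t <= D < u}| as b grows. Shifting the levels by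
   multiples of e > 0 absorbs all the errors, and e tends to 0 at the end by
   monotone continuity of the measure, so that the measure of the boundary of
   the level sets is never needed. *)

(** * Squared Euclidean norms and integrability of Gaussians *)

Lemma sqr_enorm (R : realType) n (x : 'rV[R]_n) :
  enorm x ^+ 2 = \sum_i x 0 i ^+ 2.
Proof. by rewrite sqr_sqrtr// sumr_ge0// => i _; exact: sqr_ge0. Qed.

Lemma enorm_ge0 (R : realType) n (x : 'rV[R]_n) : 0 <= enorm x.
Proof. exact: sqrtr_ge0. Qed.

Lemma enormBC (R : realType) n (x y : 'rV[R]_n) : enorm (x - y) = enorm (y - x).
Proof. by congr Num.sqrt; apply: eq_bigr => j _; rewrite !mxE -sqrrN opprB. Qed.

(** Young's inequality [2 * x * y <= k * x ^+ 2 + k^-1 * y ^+ 2] in each coordinate. It stands in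
    for the triangle inequality, because depths contain squared norms. *)
Lemma sqr_enormD_le (R : realType) n (k : R) (a b : 'rV[R]_n) : 0 < k ->
  enorm (a + b) ^+ 2 <= (1 + k) * enorm a ^+ 2 + (1 + k^-1) * enorm b ^+ 2.
Proof.
move=> k0; rewrite !sqr_enorm !mulr_sumr -big_split/=.
apply: ler_sum => i _; rewrite mxE; move: (a 0 i) (b 0 i) => x y.
have : 0 <= k^-1 * (k * x - y) ^+ 2 by rewrite mulr_ge0 ?sqr_ge0// invr_ge0 ltW.
have -> : k^-1 * (k * x - y) ^+ 2 = k * x ^+ 2 - 2 * x * y + k^-1 * y ^+ 2.
  by field; rewrite gt_eqF.
by nra.
Qed.

Lemma continuous_sqr_enormB (R : realType) n (a : 'rV[R]_n) :
  continuous (fun y : 'rV[R]_n => enorm (y - a) ^+ 2).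
Proof.
have -> : (fun y : 'rV[R]_n => enorm (y - a) ^+ 2) =
    (fun y : 'rV[R]_n => \sum_i (y 0 i - a 0 i) ^+ 2).
  by apply/funext => y; rewrite sqr_enorm; apply: eq_bigr => i _; rewrite !mxE.
apply: continuous_big => [|i _ y]; first exact: add_continuous.
have ci : (y0 0 i - a 0 i) @[y0 --> y] --> y 0 i - a 0 i.
  by apply: cvgB; [exact: coord_continuous | exact: cvg_cst].
exact: (cvgM ci ci).
Qed.

Lemma gauss1_integral_fin (R : realType) (a : R) :
  (\int[lebesgue_measure]_x (expR (- (x - a) ^+ 2))%:E < +oo)%E.
Proof.
(* Up to its peak value, the integrand is the normal density of mean [a] and variance [1 / 2]. *)
have s0 : Num.sqrt (2^-1) != 0 :> R by rewrite gt_eqF// sqrtr_gt0 invr_gt0.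
have p0 := normal_peak_gt0 s0.
have E x : (expR (- (x - a) ^+ 2))%:E =
   ((normal_peak (Num.sqrt 2^-1))^-1%:E * (normal_pdf a (Num.sqrt 2^-1) x)%:E)%E.
  rewrite -EFinM normal_pdfE// mulrA mulVf ?gt_eqF// mul1r /normal_fun sqr_sqrtr//.
  by rewrite -mulr_natr mulVf// divr1.
under eq_integral do rewrite E.
rewrite ge0_integralZl//.
- by rewrite integral_normal_pdf mule1 ltry.
- apply/measurable_EFinP; exact: measurable_normal_pdf.
- by move=> x _; rewrite lee_fin normal_pdf_ge0.
- by rewrite lee_fin invr_ge0 ltW.
Qed.

Lemma measurable_gaussian (R : realType) n (a : 'rV[R]_n) :
  measurable_fun setT (fun y : 'rV[R]_n => (expR (- enorm (y - a) ^+ 2))%:E).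
Proof.
apply/measurable_EFinP; apply: continuous_measurable_rV => y.
apply: continuous_comp; last exact: continuous_expR.
by apply: continuousN; exact: continuous_sqr_enormB.
Qed.

Lemma sqr_enorm_consrVB (R : realType) n (p : measurableTypeR R * 'rV[R]_n)
    (a : 'rV[R]_n.+1) :
  enorm (consrV p - a) ^+ 2 =
  (p.1 - a 0 ord0) ^+ 2 + enorm (p.2 - \row_i a 0 (lift ord0 i)) ^+ 2.
Proof.
have E i : (consrV p - a) 0 i = consrV p 0 i - a 0 i by rewrite !mxE.
rewrite !sqr_enorm big_ord_recl E consrV0.
have F (u v v' : R) : v = v' -> u + v = u + v' by move->.
apply: F; apply: eq_bigr => i _; rewrite E consrVS.
by rewrite 3!mxE.
Qed.

(** By induction on [n]: the first coordinate of the Gaussian splits off as a factor, and Tonelli's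
    theorem reduces the integral to dimensions [1] and [n]. *)
Lemma gaussian_integral_fin (R : realType) n (a : 'rV[R]_n) :
  (\int[lebesgue_rV n]_y (expR (- enorm (y - a) ^+ 2))%:E < +oo)%E.
Proof.
elim: n a => [|n IH] a /=.
  rewrite integral_dirac//; last exact: measurable_gaussian.
  by rewrite diracE mem_set// mul1e ltry.
pose b : 'rV[R]_n := \row_i a 0 (lift ord0 i).
have mg : measurable_fun setT (fun p : measurableTypeR R * 'rV[R]_n =>
    (expR (- enorm (consrV p - a) ^+ 2))%:E).
  apply: (measurableT_comp (measurable_gaussian a)); exact: measurable_consrV.
rewrite /lebesgue_step ge0_integral_pushforward//; last 2 first.
- exact: measurable_consrV.
- exact: measurable_gaussian.
rewrite preimage_setT fubini_tonelli1//= /fubini_F/=.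
have E x y : (expR (- enorm (consrV (x, y) - a) ^+ 2))%:E =
    ((expR (- (x - a 0 ord0) ^+ 2))%:E * (expR (- enorm (y - b) ^+ 2))%:E)%E.
  by rewrite sqr_enorm_consrVB opprD expRD.
under eq_integral => x _.
  under eq_integral do rewrite E.
  rewrite ge0_integralZl//; last first.
    exact: measurable_gaussian.
  over.
have Ifin : (\int[lebesgue_rV n]_y (expR (- enorm (y - b) ^+ 2))%:E)%E \is a fin_num.
  by rewrite ge0_fin_numE ?IH// integral_ge0.
rewrite ge0_integralZr//; last 2 first.
- apply/measurable_EFinP; apply: measurableT_comp => //.
  by apply: measurableT_comp => //; apply: measurable_funX; exact: measurable_funB.
- exact: integral_ge0.
rewrite muleC; apply: lte_mul_pinfty => //; first exact: integral_ge0.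
exact: gauss1_integral_fin.
Qed.

(** * Depth functions, their superlevel sets, and finite nets *)

Definition depth (R : realType) n (r : 'rV[R]_n -> R) (f : 'rV[R]_n -> 'rV[R]_n)
  (x y : 'rV[R]_n) : R := r x ^+ 2 - enorm (y - f x) ^+ 2.

(** The level is an extended real: at [+oo%E] the set is empty, so that (i), like (ii), concerns a
    difference of two level sets. *)
Definition level (R : realType) n (K : set 'rV[R]_n) (r : 'rV[R]_n -> R)
    (f : 'rV[R]_n -> 'rV[R]_n) (u : \bar R) : set 'rV[R]_n :=
  [set y | exists2 x, K x & (u <= (depth r f x y)%:E)%E].

Lemma near_sqr_enormB (R : realType) n (x : 'rV[R]_n) (d : R) : 0 < d ->
  \forall z \near x, enorm (z - x) ^+ 2 < d.
Proof.
move=> d0.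
have /(@cvgr_lt _ _ (nbhs x)) := @continuous_sqr_enormB R n x x; apply.
by rewrite subrr sqr_enorm big1// => j _; rewrite mxE expr0n.
Qed.

Section level.
Context {R : realType} {n : nat}.
Variables (K : set 'rV[R]_n) (r : 'rV[R]_n -> R) (f : 'rV[R]_n -> 'rV[R]_n).
Hypothesis compactK : compact K.
Hypothesis contr : {within K, continuous r}.
Hypothesis lipf : lipschitz1_on K f.

Lemma lipschitz1_on_coord_cvg x i : K x ->
  f z 0 i @[z --> within K (nbhs x)] --> f x 0 i.
Proof.
move=> Kx; apply/cvgrPdist_le => e e0.
have : \forall z \near x, enorm (z - x) ^+ 2 < e ^+ 2.
  by apply: near_sqr_enormB; rewrite exprn_gt0.
move=> xe; rewrite near_withinE; near=> z => Kz.
have ze : enorm (z - x) ^+ 2 < e ^+ 2 by near: z.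
rewrite -ler_sqr ?nnegrE ?(ltW e0)// real_normK ?num_real//.
apply: (le_trans _ (ltW ze)).
apply: (@le_trans _ _ (enorm (f x - f z) ^+ 2)).
  rewrite sqr_enorm (bigD1 i)//= !mxE lerDl sumr_ge0// => j _; exact: sqr_ge0.
by rewrite enormBC ler_sqr ?nnegrE ?enorm_ge0// lipf//; exact: mem_set.
Unshelve. all: by end_near. Qed.

Lemma continuous_depthl y : {within K, continuous (depth r f ^~ y)}.
Proof.
apply/subspace_continuousP => x Kx.
have rx : r z @[z --> within K (nbhs x)] --> r x.
  by move/subspace_continuousP : contr; exact.
apply: cvgB; first exact: (cvgM rx rx).
rewrite sqr_enorm.
under eq_fun do rewrite sqr_enorm.
apply: cvg_big => [|i _]; first exact: add_continuous.
rewrite !mxE.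
under eq_fun do rewrite !mxE.
have h : y 0 i - f z 0 i @[z --> within K (nbhs x)] --> y 0 i - f x 0 i.
  by apply: cvgB; [exact: cvg_cst | exact: lipschitz1_on_coord_cvg].
exact: (cvgM h h).
Qed.

Lemma continuous_depthr x : continuous (depth r f x).
Proof.
have -> : depth r f x = (fun a => r x ^+ 2 - a) \o (fun y => enorm (y - f x) ^+ 2).
  by [].
move=> y; apply: continuous_comp; first exact: continuous_sqr_enormB.
by apply: cvgB; [exact: cvg_cst | exact: cvg_id].
Qed.

(** By compactness the depth at [y] attains its maximum over [K], and one maximiser serves for every
    [e]. *)
Lemma level_limit t y :
  (forall e, 0 < e -> level K r f (t - e)%:E y) -> level K r f t%:E y.
Proof.
move=> H.
have K0 : K !=set0 by have [x Kx _] := H 1 ltr01; exists x.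
have [x /set_mem Kx xmax] := EVT_max_rV K0 compactK (@continuous_depthl y).
exists x => //; rewrite lee_fin; apply/ler_addgt0Pr => e e0.
have [z Kz] := H _ e0; rewrite lee_fin => /le_trans/(_ (xmax z _)).
by rewrite lerBlDr; apply; exact: mem_set.
Qed.

Lemma le_level u v : (u <= v)%E -> level K r f v `<=` level K r f u.
Proof. by move=> uv y [x Kx vx]; exists x => //; exact: le_trans vx. Qed.

(** [K] may be uncountable, so for a real level the set is written as a countable intersection of
    open sets; [level_limit] recovers the large inequality from the strict ones. *)
Lemma measurable_level u : measurable (level K r f u).
Proof.
case: u => [t| |].
- have -> : level K r f t%:E = \bigcap_(k : nat) \bigcup_(x in K)
      [set y | t - k.+1%:R^-1 < depth r f x y].
    apply/seteqP; split=> [y [x Kx tx] k _|y yk].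
      rewrite lee_fin in tx; exists x => //=; apply: lt_le_trans tx; rewrite ltrBlDr ltrDl.
      by rewrite invr_gt0.
    apply: level_limit => e e0.
    have [k ke] : exists k, k.+1%:R^-1 <= e.
      exists (Num.truncn e^-1).
      rewrite -[leRHS]invrK lef_pV2 ?posrE ?invr_gt0//.
      by rewrite ltW// truncnS_gt.
    have [x Kx /= xk] := yk k I.
    exists x => //; rewrite lee_fin; apply: le_trans (ltW xk).
    by rewrite lerB.
  apply: bigcapT_measurable => k; apply: open_measurable_rV.
  apply: bigcup_open => x Kx.
  have -> : [set y | t - k.+1%:R^-1 < depth r f x y] =
      depth r f x @^-1` `]t - k.+1%:R^-1, +oo[.
    by apply/seteqP; split => y /=; rewrite in_itv/= andbT.
  move/continuousP : (@continuous_depthr x); apply; exact: interval_open.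
- have -> : level K r f +oo%E = set0 by apply/seteqP; split => y // [x _].
  exact: measurable0.
- have [->|/set0P[x Kx]] := eqVneq K set0.
    have -> : level set0 r f -oo%E = set0 by apply/seteqP; split => y // [x].
    exact: measurable0.
  have -> : level K r f -oo%E = setT.
    by apply/seteqP; split => y // _; exists x => //; exact: leNye.
  exact: measurableT.
Qed.

End level.

(** The net does not depend on [f]: closeness in [K] is inherited by the images under the Lipschitz
    condition, so the same points serve for [id] and for [T]. The loss [e] is shared equally between
    [r] and the two error terms of [sqr_enormD_le]. *)
Lemma depth_net (R : realType) n (K : set 'rV[R]_n) (r : 'rV[R]_n -> R)
    (t e : R) :
  compact K -> {within K, continuous r} -> K !=set0 -> 0 < e ->
  exists N (p : nat -> 'rV[R]_n), [/\ (0 < N)%N, (forall i, K (p i)) &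
    forall f, lipschitz1_on K f -> forall x y, K x -> t <= depth r f x y ->
    exists2 i, (i < N)%N & depth r f x y - e <= depth r f (p i) y].
Proof.
move=> compactK contr K0 e0.
have contr2 : {within K, continuous (fun x => r x ^+ 2)}.
  apply/subspace_continuousP => x Kx; move/subspace_continuousP : contr => /(_ _ Kx) rx.
  exact: (cvgM rx rx).
have [xm /set_mem Kxm xmax] := EVT_max_rV K0 compactK contr2.
(* [D] bounds [enorm (y - f x) ^+ 2] wherever the depth is at least [t]; adding [1] keeps it
   positive. *)
pose D := Num.max (r xm ^+ 2 - t) 0 + 1.
have D0 : 0 < D by rewrite ltr_wpDl// le_max lexx orbT.
(* [k] and [d] are chosen to make both [k * D] and [(1 + k^-1) * d] equal to [e / 3]. *)
pose k := e / (3 * D).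
have k0 : 0 < k by rewrite divr_gt0// mulr_gt0.
pose d := e / (3 * (1 + k^-1)).
have kV0 : 0 < 1 + k^-1 by rewrite addr_gt0// invr_gt0.
have d0 : 0 < d by rewrite divr_gt0// mulr_gt0.
(* [K x] is a premise because neighbourhoods are taken in the whole space, while [r] is continuous
   on [K] only. *)
pose good (z x : 'rV[R]_n) := K x -> r x ^+ 2 - r z ^+ 2 <= e / 3 /\
                                    enorm (x - z) ^+ 2 <= d.
pose V z : set 'rV[R]_n := ([set x | good z x])°.
move: (compactK); rewrite compact_cover => /(_ _ K V) [].
- by move=> z _; exact: open_interior.
- move=> z Kz; exists z => //.
  have h1 : \forall x \near z, enorm (x - z) ^+ 2 < d.
    exact: near_sqr_enormB.
  have h2 : \forall x \near z, K x -> r x ^+ 2 < r z ^+ 2 + e / 3.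
    suff: \forall x \near within K (nbhs z), r x ^+ 2 < r z ^+ 2 + e / 3 by rewrite near_withinE.
    move/subspace_continuousP : contr2 => /(_ _ Kz)/cvgr_lt; apply.
    by rewrite ltrDl divr_gt0.
  rewrite /V/interior/=; near=> x => Kx; split.
    by rewrite lerBlDl ltW//; move: Kx; near: x.
  by rewrite ltW//; near: x.
move=> F FK KF.
have [x0 Kx0] := K0.
have x0F : exists z, z \in F.
  have [z zF _] := KF _ Kx0; by exists z.
have [z0 z0F] := x0F.
(* The default [z0] of [nth] lies in [F], so that [K (p i)] holds for every index, also beyond the
   size. *)
exists (size (enum_fset F)), (fun i => nth z0 (enum_fset F) i); split.
- have : z0 \in enum_fset F := z0F.
  by case: (enum_fset F).
- move=> i; have [iF|iF] := ltnP i (size (enum_fset F)).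
    exact: (set_mem (FK _ (mem_nth z0 iF))).
  by rewrite nth_default//; exact: (set_mem (FK _ z0F)).
move=> f lipf x y Kx tx.
have [z zF /interior_subset/= /(_ Kx)[h1 h2]] := KF _ Kx.
exists (index z (enum_fset F)); first by rewrite index_mem.
rewrite nth_index//.
have Kz : K z by exact: (set_mem (FK _ zF)).
have := @sqr_enormD_le R n k (y - f x) (f x - f z) k0.
rewrite addrA subrK.
have h3 : enorm (f x - f z) ^+ 2 <= d.
  apply: le_trans h2; rewrite ler_sqr ?nnegrE ?enorm_ge0//.
  by apply: lipf; exact: mem_set.
have h4 : enorm (y - f x) ^+ 2 <= D.
  have : r x ^+ 2 <= r xm ^+ 2 by apply: xmax; exact: mem_set.
  have : r xm ^+ 2 - t <= Num.max (r xm ^+ 2 - t) 0 by rewrite le_max lexx.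
  move: tx; rewrite /depth /D; lra.
have h5 : k * enorm (y - f x) ^+ 2 <= e / 3.
  apply: (@le_trans _ _ (k * D)); first by rewrite ler_pM2l.
  have -> // : k * D = e / 3 by rewrite /k; field; rewrite gt_eqF.
have h6 : (1 + k^-1) * enorm (f x - f z) ^+ 2 <= e / 3.
  apply: (@le_trans _ _ ((1 + k^-1) * d)); first by rewrite ler_pM2l.
  rewrite /d; move: (1 + k^-1) kV0 => w w0.
  have -> // : w * (e / (3 * w)) = e / 3 by field; rewrite gt_eqF.
rewrite /depth mulrDl mul1r; lra.
Unshelve. all: by end_near. Qed.

(** * Discrete measures and their Gaussian mixtures *)

Lemma discrete_probability d (T : measurableType d) (R : realType) (N : nat)
    (p : nat -> T) (w : nat -> R) : (forall i, 0 < w i) -> (0 < N)%N ->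
  exists mu : probability T R, forall A : set T,
    mu A = (\sum_(i < N) (w i / \sum_(j < N) w j)%:E * \d_(p i) A)%E.
Proof.
move=> w0 N0; set Z := \sum_(j < N) w j.
have Z0 : 0 < Z.
  case: N N0 @Z => // N _; rewrite big_ord_recl/= ltr_pwDl//.
  by apply: sumr_ge0 => i _; exact: ltW.
pose m : {measure set T -> \bar R} := msum (fun i => mscale (NngNum (ltW (w0 i))) (\d_(p i))) N.
have mE A : m A = (\sum_(i < N) (w i)%:E * \d_(p i) A)%E by [].
have mT : m setT = Z%:E.
  rewrite mE -sumEFin; apply: eq_bigr => i _.
  by rewrite diracT mule1.
(* The Dirac mass is the fallback of [mnormalize] for zero or infinite total mass; here the total
   mass [Z] is positive and finite. *)
exists (mnormalize m (\d_(p 0%N))) => A.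
change (mnormalize m (\d_(p 0%N)) A = \sum_(i < N) (w i / Z)%:E * \d_(p i) A)%E.
rewrite /mnormalize mT eqe gt_eqF//= mE ge0_sume_distrl.
  apply: eq_bigr => i _.
  by rewrite muleAC -EFinM.
by move=> i _; rewrite mule_ge0// lee_fin ltW.
Qed.

(** [nu] is a bare set function because [pushforward_on] carries no measure structure; its values
    identify it with a sum of weighted Dirac masses. *)
Lemma ge0_integral_sum_dirac d (T : measurableType d) (R : realType) (N : nat)
    (q : nat -> T) (c : nat -> R) (nu : set T -> \bar R) (g : T -> R) :
  (forall i, 0 <= c i) ->
  (forall A, nu A = (\sum_(i < N) (c i)%:E * \d_(q i) A)%E) ->
  measurable_fun setT g -> (forall x, 0 <= g x) ->
  (\int[nu]_y (g y)%:E = (\sum_(i < N) c i * g (q i))%:E)%E.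
Proof.
move=> c0 nuE mg g0.
have -> : nu = msum (fun i => mscale (NngNum (c0 i)) (\d_(q i))) N.
  by apply/funext => A; rewrite nuE.
have mg' : measurable_fun setT (EFin \o g) by exact/measurable_EFinP.
rewrite ge0_integral_measure_sum//; last by move=> x _; rewrite lee_fin.
rewrite -sumEFin; apply: eq_bigr => i _.
rewrite ge0_integral_mscale//; last by move=> x _; rewrite lee_fin.
by rewrite integral_dirac// diracT mul1e.
Qed.

(* Up to normalisation, the density at time [(2 * b)^-1] of the discrete
   measure of weights [expR (b * r (p i) ^+ 2)]; it is comparable to
   [expR (b * m)], with [m] the largest depth over the net [p]. *)
Definition mixture (R : realType) n (r : 'rV[R]_n -> R) (f : 'rV[R]_n -> 'rV[R]_n)
    (N : nat) (p : nat -> 'rV[R]_n) (b : R) (y : 'rV[R]_n) : R :=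
  \sum_(i < N) expR (b * depth r f (p i) y).

Lemma mixture_ge0 (R : realType) n (r : 'rV[R]_n -> R) f N p b y :
  0 <= mixture r f N p b y.
Proof. by apply: sumr_ge0 => i _; exact: expR_ge0. Qed.

Lemma measurable_mixture (R : realType) n (r : 'rV[R]_n -> R) f N p b :
  measurable_fun setT (mixture r f N p b).
Proof.
apply: measurable_sum => i; apply: measurableT_comp => //.
apply: measurable_funM => //; apply: continuous_measurable_rV.
exact: continuous_depthr.
Qed.

(** At time [(2 * b)^-1] the Gaussian exponent is [- b] times the squared distance, and the weight
    [expR (b * r (p i) ^+ 2)] completes it to [b] times the depth. *)
Lemma gauss_conv_discrete (R : realType) n (r : 'rV[R]_n -> R)
    (f : 'rV[R]_n -> 'rV[R]_n) (N : nat) (p : nat -> 'rV[R]_n) (b Z : R)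
    (nu : set 'rV[R]_n -> \bar R) (x : 'rV[R]_n) : 0 < b -> 0 < Z ->
  (forall A, nu A =
    (\sum_(i < N) (expR (b * r (p i) ^+ 2) / Z)%:E * \d_(f (p i)) A)%E) ->
  gauss_conv nu (2 * b)^-1 x =
  (2 * pi * (2 * b)^-1) `^ (- (n%:R / 2)) / Z * mixture r f N p b x.
Proof.
move=> b0 Z0 nuE; rewrite /gauss_conv.
rewrite (@ge0_integral_sum_dirac _ _ _ N (f \o p)
  (fun i => expR (b * r (p i) ^+ 2) / Z) nu)//=; last 3 first.
- by move=> i; rewrite divr_ge0 ?expR_ge0// ltW.
- apply: measurable_funM => //; apply: measurableT_comp => //.
  apply: measurableT_comp => //; apply: measurable_funM => //.
  under eq_fun do rewrite enormBC.
  by apply: continuous_measurable_rV; exact: continuous_sqr_enormB.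
- by move=> y; rewrite mulr_ge0 ?powR_ge0 ?expR_ge0.
rewrite /mixture mulr_sumr; apply: eq_bigr => i _; rewrite /gauss.
have -> : enorm (x - f (p i)) ^+ 2 / (2 * (2 * b)^-1) = b * enorm (x - f (p i)) ^+ 2.
  by field; rewrite gt_eqF.
rewrite /depth mulrBr expRD; ring.
Qed.

(** [T] moves the atoms and keeps their weights, whence the common factor [l]. As the atoms lie in
    [K], the restriction to [K] in [pushforward_on] loses no mass. *)
Lemma exists_discretization (R : realType) n (K : set 'rV[R]_n) T
    (r : 'rV[R]_n -> R) (N : nat) (p : nat -> 'rV[R]_n) (b : R) :
  (forall i, K (p i)) -> (0 < N)%N -> 0 < b ->
  exists (mu : probability 'rV[R]_n R) (l : R), [/\ mu K = 1%E, 0 < l,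
    gauss_conv mu (2 * b)^-1 = (fun x => l * mixture r id N p b x) &
    gauss_conv (pushforward_on K T mu) (2 * b)^-1 =
      (fun x => l * mixture r T N p b x)].
Proof.
move=> Kp N0 b0; pose w i := expR (b * r (p i) ^+ 2).
have w0 i : 0 < w i by exact: expR_gt0.
have [mu muE] := discrete_probability p w0 N0.
move: muE; set Z := \sum_(j < N) w j => muE.
have Z0 : 0 < Z.
  case: N N0 {muE} @Z => // N _; rewrite big_ord_recl/= ltr_pwDl//.
  by apply: sumr_ge0 => i _; exact: ltW.
exists mu, ((2 * pi * (2 * b)^-1) `^ (- (n%:R / 2)) / Z); split.
- rewrite muE (eq_bigr (fun i : 'I_N => (w i / Z)%:E)) => [|i _].
    by rewrite sumEFin -mulr_suml divff// gt_eqF.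
  by rewrite diracE mem_set// mule1.
- by rewrite divr_gt0// powR_gt0// !mulr_gt0 ?pi_gt0 ?invr_gt0 ?mulr_gt0.
- by apply/funext => x; exact: gauss_conv_discrete.
- apply/funext => x; apply: gauss_conv_discrete => // A.
  rewrite /pushforward_on muE; apply: eq_bigr => i _; congr (_ * _)%E.
  rewrite !diracE; congr (_%:R%:E); apply: congr1.
  by apply/idP/idP => [/set_mem[_ ?]|/set_mem ?]; exact/mem_set.
Qed.

(** A finite sum of Gaussians. The case [b = 1] is the fixed integrable majorant of the tails for
    all larger [b] in use. *)
Lemma mixture_integral_fin (R : realType) n (r : 'rV[R]_n -> R) f N p :
  (\int[lebesgue_rV n]_y (mixture r f N p 1 y)%:E < +oo)%E.
Proof.
have E y : (mixture r f N p 1 y)%:E = (\sum_(i < N) (expR (r (p i) ^+ 2))%:E *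
    (expR (- enorm (y - f (p i)) ^+ 2))%:E)%E.
  rewrite /mixture -sumEFin; apply: eq_bigr => i _.
  by rewrite mul1r /depth expRD EFinM.
under eq_integral do rewrite E.
rewrite ge0_integral_sum//; last first.
  by move=> i; apply: measurable_funeM; exact: measurable_gaussian.
apply: lte_sum_pinfty => i _.
rewrite ge0_integralZl//; last exact: measurable_gaussian.
by apply: lte_mul_pinfty => //; exact: gaussian_integral_fin.
Qed.

(** * Truncated linear energy densities *)

Definition capped (R : realType) (a : R) (b : \bar R) (z : R) : R :=
  if (z%:E <= b)%E then - Num.min (z / a) 1 else 0.

Section capped.
Context {R : realType}.
Implicit Types (a z : R) (b : \bar R).

Lemma measurable_capped a b : measurable_fun setT (capped a b).
Proof.
have mm : measurable_fun setT (fun z : R => - Num.min (z / a) 1).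
  apply: measurableT_comp => //; apply: measurable_minr => //.
  exact: measurable_funM.
case: b => [b| |].
- apply: measurable_fun_ifT => //.
  have -> : (fun z : R => (z%:E <= b%:E)%E) = (fun z => z <= b) by apply/funext => z; rewrite lee_fin.
  exact: measurable_fun_ler.
- rewrite (_ : capped a +oo%E = (fun z : R => - Num.min (z / a) 1))//.
  by apply/funext => z; rewrite /capped leey.
- rewrite (_ : capped a -oo%E = cst 0)//.
Qed.

Lemma capped_energy_density a b : energy_density (capped a b).
Proof.
split; first exact: measurable_funTS (measurable_capped a b).
rewrite /capped mul0r /Num.min ltr01 oppr0; by case: ifP.
Qed.

(** This sign makes the energies of [capped a b] always defined, with values in [[-oo, 0]]. *)
Lemma capped_le0 a b z : 0 < a -> 0 <= z -> capped a b z <= 0.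
Proof.
move=> a0 z0; rewrite /capped; case: ifP => // _.
by rewrite oppr_le0 le_min ler01 divr_ge0// ltW.
Qed.

(** The minimum of a linear function and a constant is concave. *)
Lemma capped_nondecreasing_pressure a :
  0 < a -> nondecreasing_pressure (capped a +oo%E).
Proof.
move=> a0 t x y _ _; rewrite /capped !leey.
have H : forall p X Y : R, 0 <= p -> p <= 1 ->
    - Num.min ((p * X + (1 - p) * Y) / a) 1 <=
    p * - Num.min (X / a) 1 + (1 - p) * - Num.min (Y / a) 1; last exact: H.
move=> p X Y p0 p1; rewrite mulrDl -!mulrA !mulrN -opprD lerN2 le_min.
have q0 : 0 <= 1 - p by rewrite subr_ge0.
apply/andP; split.
  by apply: lerD; apply: ler_wpM2l => //; rewrite ge_min lexx.
rewrite -[leRHS](_ : p * 1 + (1 - p) * 1 = 1); last by ring.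
by apply: lerD; apply: ler_wpM2l => //; rewrite ge_min lexx orbT.
Qed.

(** Up to [b] the quotient by [z] is [- Num.min a^-1 z^-1], nondecreasing and nonpositive; beyond
    [b] it jumps up to [0]. *)
Lemma capped_nonnegative_pressure a b :
  0 < a -> nonnegative_pressure (capped a b).
Proof.
move=> a0 s t; rewrite !in_itv/= !andbT => s0 t0 st.
rewrite /capped; have [tb|tb] := boolP (t%:E <= b)%E; last first.
  rewrite mul0r; case: ifPn => _; last by rewrite mul0r.
  rewrite mulNr oppr_le0 divr_ge0 ?(ltW s0)//.
  by rewrite le_min ler01 divr_ge0// ltW.
rewrite (le_trans _ tb) ?lee_fin// !mulNr lerN2.
have H z : 0 < z -> Num.min (z / a) 1 / z = Num.min a^-1 z^-1.
  move=> z0; rewrite minr_pMl ?invr_ge0 ?ltW// mul1r; congr (Num.min _ _).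
  by rewrite mulrAC divff ?gt_eqF// mul1r.
by rewrite !H// le_min !ge_min lexx/= [t^-1 <= _]lef_pV2 ?posrE// st orbT.
Qed.

End capped.

(** * Size of the mixtures inside and outside level sets *)

Lemma mixture_ge_of_level (R : realType) n (r : 'rV[R]_n -> R) f N p (K : set 'rV[R]_n)
    (t e b v : R) y : 0 <= b ->
  (forall x y, K x -> t <= depth r f x y ->
    exists2 i, (i < N)%N & depth r f x y - e <= depth r f (p i) y) ->
  t <= v -> level K r f v%:E y -> expR (b * (v - e)) <= mixture r f N p b y.
Proof.
move=> b0 net tv [x Kx]; rewrite lee_fin => vx.
have [i iN xi] := net x y Kx (le_trans tv vx).
rewrite /mixture (bigD1 (Ordinal iN))//=; apply: ler_wpDr.
  by apply: sumr_ge0 => j _; exact: expR_ge0.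
by rewrite ler_expR ler_wpM2l// (le_trans _ xi)// lerB.
Qed.

(** Each of the [N] exponents is at most [b * v]; for large [b] the factor [N] costs only a small
    shift of the level. *)
Lemma mixture_le_of_notin_level (R : realType) n (r : 'rV[R]_n -> R) f N p
    (K : set 'rV[R]_n) (b v : R) y : 0 <= b -> (forall i, K (p i)) ->
  ~ level K r f v%:E y -> mixture r f N p b y <= N%:R * expR (b * v).
Proof.
move=> b0 Kp yv; rewrite -[N in N%:R]card_ord mulr_natl -sumr_const.
apply: ler_sum => i _; rewrite ler_expR ler_wpM2l// ltW// ltNge.
by apply/negP => vi; apply: yv; exists (p i) => //; rewrite lee_fin.
Qed.

(* Outside the level set the exponents [depth - t + e] are below [- e], hence
   dominated, when [b >= 4], by the integrable ones at [b = 1], with a gain that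
   vanishes as [b] grows. *)
Lemma mixture_tail (R : realType) n (r : 'rV[R]_n -> R) f N p
    (K : set 'rV[R]_n) (b t e : R) y : 4 <= b -> 0 < e -> (forall i, K (p i)) ->
  ~ level K r f (t - 2 * e)%:E y ->
  mixture r f N p b y / expR (b * (t - e)) <=
    expR (- t - e * b / 2) * mixture r f N p 1 y.
Proof.
move=> b4 e0 Kp yt; rewrite -expRN mulr_suml mulr_sumr.
apply: ler_sum => i _; rewrite -!expRD ler_expR mul1r.
have : depth r f (p i) y < t - 2 * e.
  by rewrite ltNge; apply/negP => vi; apply: yt; exists (p i) => //; rewrite lee_fin.
(* Inserting [d < t - 2 * e] leaves [2 * e <= e * b / 2], whence the bound [4 <= b]. *)
move: (depth r f (p i) y) => d dt; nra.
Qed.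

(** * Comparison of energies at shifted levels *)

Lemma energy_defined_le0 (R : realType) n (U : R -> R) (rho : 'rV[R]_n -> R) :
  (forall x, U (rho x) <= 0) -> energy_defined U rho.
Proof.
move=> U0; left; rewrite (eq_integral (cst 0%E)) ?integral0//.
by apply: le0_funeposE => x _; rewrite lee_fin.
Qed.

Lemma internal_energyN (R : realType) n (U : R -> R) (rho : 'rV[R]_n -> R) :
  (forall x, U (rho x) <= 0) ->
  (internal_energy U rho = - \int[lebesgue_rV n]_x (- U (rho x))%:E)%E.
Proof.
move=> U0; rewrite /internal_energy -integral_ge0N.
  by apply: eq_integral => x _; rewrite EFinN oppeK.
by move=> x _; rewrite lee_fin oppr_ge0.
Qed.

(** As [expR x >= 1 + x], each summand of the witness secures one condition: [4] the first,
    [N%:R / e] the second, [2 * H / (e * d)] the third. *)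
Lemma inverse_temperature (R : realType) (e d H : R) (N : nat) :
  0 < e -> 0 < d -> 0 <= H ->
  exists b : R, [/\ 4 <= b, N%:R <= expR (b * e) & expR (- e * b / 2) * H <= d].
Proof.
move=> e0 d0 H0; exists (4 + N%:R / e + 2 * H / (e * d)).
have A : 0 <= N%:R / e by rewrite divr_ge0// ltW.
have B : 0 <= 2 * H / (e * d) by rewrite divr_ge0 ?mulr_ge0// ltW.
split; first by lra.
- apply: le_trans (expR_ge1Dx _).
  have E : (4 + N%:R / e + 2 * H / (e * d)) * e =
      4 * e + N%:R + 2 * H / (e * d) * e by field; rewrite !gt_eqF.
  rewrite E; have : 0 <= 2 * H / (e * d) * e by rewrite mulr_ge0// ltW.
  lra.
- rewrite (_ : - e * _ / 2 = - (e * (4 + N%:R / e + 2 * H / (e * d)) / 2)); last by ring.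
  rewrite expRN mulrC ler_pdivrMr ?expR_gt0//.
  apply: (@le_trans _ _ (d * (e * (4 + N%:R / e + 2 * H / (e * d)) / 2))); last first.
    rewrite ler_pM2l//; apply: le_trans (expR_ge1Dx _); lra.
  have -> : d * (e * (4 + N%:R / e + 2 * H / (e * d)) / 2) =
    2 * d * e + d * N%:R / 2 + H by field; rewrite !gt_eqF.
  have : 0 <= d * e by rewrite mulr_ge0// ltW.
  have : 0 <= d * N%:R by rewrite mulr_ge0// ltW.
  lra.
Qed.

(** The negated energy is at least the left measure for [T], and at most the right measure plus an
    arbitrary [d] for [id]. The condition linking [u] and [b] lets one statement cover both pressure
    classes: at [u = +oo%E] only densities without cut-off are required. *)
Lemma level_shrunk_le (R : realType) n (K : set 'rV[R]_n)
    (T : 'rV[R]_n -> 'rV[R]_n) (r : 'rV[R]_n -> R) (pressure : (R -> R) -> Prop)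
    (t e : R) (u : \bar R) :
  compact K -> lipschitz1_on K T -> {within K, continuous r} -> K !=set0 ->
  0 < e -> (t%:E <= u)%E ->
  (forall a b, 0 < a -> (u = +oo%E -> b = +oo%E) -> pressure (capped a b)) ->
  energies_ordered K T pressure ->
  (lebesgue_rV n (level K r T t%:E `\` level K r T (u - (2 * e)%:E)) <=
   lebesgue_rV n (level K r id (t - 2 * e)%:E `\` level K r id u))%E.
Proof.
move=> compactK lipT contr K0 e0 tu capP Eord.
have lipid : lipschitz1_on K id by [].
(* A net of precision [e / 2] rather than [e] leaves room for a strict inequality at the cut-off. *)
have e20 : 0 < e / 2 by rewrite divr_gt0.
have [N [p [N0 Kp net]]] := depth_net t compactK contr K0 e20.
set C := (\int[lebesgue_rV n]_y (mixture r id N p 1 y)%:E)%E.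
have C0 : (0 <= C)%E by apply: integral_ge0 => y _; rewrite lee_fin mixture_ge0.
have Cfin : C \is a fin_num by rewrite ge0_fin_numE// mixture_integral_fin.
apply/lee_addgt0Pr => d d0.
have H0 : 0 <= expR (- t) * fine C by rewrite mulr_ge0 ?expR_ge0 ?fine_ge0.
have [b [b4 Nb tail]] := inverse_temperature N e0 d0 H0.
have b0 : 0 < b by lra.
have [mu [l [muK l0 rho1 rho2]]] := exists_discretization T r Kp N0 b0.
(* Both heights lie [e] below [t] and [u], halfway to the shifted levels; the factor [l] cancels
   that of the densities. *)
pose a := l * expR (b * (t - e)).
pose q := if u is v%:E then (l * expR (b * (v - e)))%:E else +oo%E.
have a0 : 0 < a by rewrite mulr_gt0// expR_gt0.
pose g f y := - capped a q (l * mixture r f N p b y).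
have le0 f y : capped a q (l * mixture r f N p b y) <= 0.
  by rewrite capped_le0// mulr_ge0 ?mixture_ge0// ltW.
have g0 f y : 0 <= g f y by rewrite oppr_ge0.
have mg f : measurable_fun setT (EFin \o g f).
  apply/measurable_EFinP; apply: measurableT_comp => //.
  apply: measurableT_comp; first exact: measurable_capped.
  by apply: measurable_funM => //; exact: measurable_mixture.
have mlevel f v : lipschitz1_on K f -> measurable (level K r f v).
  by move=> ?; exact: measurable_level.
have : (\int[lebesgue_rV n]_y (g T y)%:E <= \int[lebesgue_rV n]_y (g id y)%:E)%E.
  have gE f : (\int[lebesgue_rV n]_y (g f y)%:E =
      - internal_energy (capped a q) (fun y => l * mixture r f N p b y)%R)%E.
    by rewrite internal_energyN ?oppeK// => x; exact: le0.
  rewrite [leLHS](gE T) [leRHS](gE id) leeN2.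
  have := Eord mu (2 * b)^-1 (capped a q) muK.
  rewrite rho1 rho2; apply.
  - by rewrite invr_gt0 mulr_gt0.
  - exact: capped_energy_density.
  - by apply: capP => // uoo; rewrite /q uoo.
  - by apply: energy_defined_le0 => x; exact: le0.
  - by apply: energy_defined_le0 => x; exact: le0.
set S := level K r T t%:E `\` _.
(* On [S] the integrand equals [1]: the mixture exceeds the height [t - e], and stays below the
   cut-off because [N%:R <= expR (b * e)] absorbs the number of terms. *)
have lower : (lebesgue_rV n S <= \int[lebesgue_rV n]_y (g T y)%:E)%E.
  have mS : measurable S by apply: measurableD; exact: mlevel.
  rewrite -[S]setIT -integral_indic//.
  apply: ge0_le_integral => //; first exact/measurable_EFinP/measurable_indic.
    exact: mg.
  move=> y _; rewrite lee_fin indicE.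
  have [Sy|nSy] := pselect (S y); last by rewrite memNset.
  rewrite mem_set//; have [yt yu] := Sy.
  have ht : expR (b * (t - e)) <= mixture r T N p b y.
    apply: le_trans (mixture_ge_of_level (ltW b0) (net T lipT) (lexx t) yt).
    by rewrite ler_expR ler_wpM2l ?(ltW b0)//; lra.
  rewrite /g /capped ifT.
    rewrite opprK le_min lexx andbT ler_pdivlMr// mul1r.
    by rewrite ler_pM2l.
  rewrite /q; move: tu yu; case: (u) => // [v tv yv|_ _]; last by rewrite leey.
  rewrite -EFinB in yv; rewrite lee_fin ler_pM2l//.
  apply: (le_trans (mixture_le_of_notin_level N (ltW b0) Kp yv)).
  apply: (le_trans (ler_wpM2r (expR_ge0 _) Nb)).
  by rewrite -expRD ler_expR -mulrDr ler_wpM2l ?(ltW b0)//; lra.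
move=> /(le_trans lower)/le_trans; apply.
have mS : measurable (level K r id (t - 2 * e)%:E `\` level K r id u).
  by apply: measurableD; exact: mlevel.
pose c := expR (- t - e * b / 2).
(* Three cases: the cut-off kills the integrand on the level set of [u]; elsewhere it is at most [1]
   on the level set of [t - 2 * e], and at most the tail bound outside it. *)
apply: (@le_trans _ _ (\int[lebesgue_rV n]_y
    ((\1_(level K r id (t - 2 * e)%:E `\` level K r id u) y)%:E +
     c%:E * (mixture r id N p 1 y)%:E))%E).
  apply: ge0_le_integral => //.
  - by move=> y _; rewrite lee_fin g0.
  - exact: mg.
  - apply: emeasurable_funD; first exact/measurable_EFinP/measurable_indic.
    apply: measurable_funeM; apply/measurable_EFinP; exact: measurable_mixture.
  move=> y _; rewrite -EFinM -EFinD lee_fin.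
  have cm0 : 0 <= c * mixture r id N p 1 y by rewrite mulr_ge0 ?expR_ge0 ?mixture_ge0.
  have [yu|yu] := pselect (level K r id u y).
    suff -> : g id y = 0 by rewrite addr_ge0.
    rewrite /g /capped ifF ?oppr0//; apply/negbTE; rewrite -ltNge.
    rewrite /q; move: tu yu; case: (u) => // [v|_ [x _]]; last by [].
    rewrite lee_fin => tv yv; rewrite lte_fin ltr_pM2l//.
    apply: lt_le_trans (mixture_ge_of_level (ltW b0) (net id lipid) tv yv).
    by rewrite ltr_expR ltr_pM2l//; lra.
  have gE : g id y <= Num.min (l * mixture r id N p b y / a) 1.
    rewrite /g /capped; case: ifP => _; first by rewrite opprK.
    by rewrite oppr0 le_min ler01 divr_ge0 ?mulr_ge0 ?mixture_ge0// ltW.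
  apply: (le_trans gE); rewrite ge_min indicE.
  have [yt|yt] := pselect (level K r id (t - 2 * e)%:E y).
    by rewrite [in X in _ || X]mem_set// lerDl cm0 orbT.
  rewrite memNset; last by case.
  rewrite add0r; apply/orP; left; apply: le_trans (mixture_tail N b4 e0 Kp yt).
  rewrite /a invfM mulrACA divff ?gt_eqF// mul1r//.
rewrite ge0_integralD//; last 3 first.
- exact/measurable_EFinP/measurable_indic.
- by move=> y _; rewrite -EFinM lee_fin mulr_ge0 ?expR_ge0 ?mixture_ge0.
- apply: measurable_funeM; apply/measurable_EFinP; exact: measurable_mixture.
rewrite integral_indic// setIT; apply: leeD => //.
rewrite ge0_integralZl//; last 3 first.
- apply/measurable_EFinP; exact: measurable_mixture.
- by move=> y _; rewrite lee_fin mixture_ge0.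
- by rewrite lee_fin expR_ge0.
rewrite -/C -(fineK Cfin) -EFinM lee_fin /c expRD mulrAC mulrC.
by rewrite !mulNr in tail.
Qed.

(** * Passage to the limit in the shifts *)

Lemma level_limit_seq (R : realType) n (K : set 'rV[R]_n) (r : 'rV[R]_n -> R)
    (f : 'rV[R]_n -> 'rV[R]_n) (u : \bar R) y :
  compact K -> {within K, continuous r} -> lipschitz1_on K f ->
  (-oo < u)%E -> (forall k : nat, level K r f (u - (2 * k.+1%:R^-1)%:E)%E y) ->
  level K r f u y.
Proof.
move=> compactK contr lipf; case: u => [t| |]// _ H; last exact: (H 0%N).
apply: level_limit => // e e0.
have e20 : 0 < 2 / e by rewrite divr_gt0.
have := H (Num.truncn (2 / e)); apply: le_level.
rewrite lee_fin lerB// ler_pdivrMr// mulrC -ler_pdivrMr//.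
by rewrite ltW// truncnS_gt.
Qed.

(** Markov's inequality for the mixture at [b = 1] over a net of precision [1]: on the level set it
    is at least [expR (t - 1)]. *)
Lemma level_fin_measure (R : realType) n (K : set 'rV[R]_n) (r : 'rV[R]_n -> R)
    (f : 'rV[R]_n -> 'rV[R]_n) (t : R) :
  compact K -> {within K, continuous r} -> lipschitz1_on K f -> K !=set0 ->
  (lebesgue_rV n (level K r f t%:E) < +oo)%E.
Proof.
move=> compactK contr lipf K0.
have [N [p [_ _ /(_ f lipf) net]]] := depth_net t compactK contr K0 ltr01.
have mS := measurable_level compactK contr lipf t%:E.
apply: (@le_lt_trans _ _ (\int[lebesgue_rV n]_y
    ((expR (1 - t))%:E * (mixture r f N p 1 y)%:E))%E).
  rewrite -[level K r f t%:E]setIT -integral_indic//.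
  apply: ge0_le_integral => //.
  - exact/measurable_EFinP/measurable_indic.
  - apply: measurable_funeM; apply/measurable_EFinP; exact: measurable_mixture.
  move=> y _; rewrite -EFinM lee_fin indicE.
  have [/set_mem yt|_] := boolP (y \in _); last first.
    by rewrite mulr_ge0 ?expR_ge0 ?mixture_ge0.
  apply: (@le_trans _ _ (expR (1 - t) * expR (1 * (t - 1)))).
    by rewrite -expRD (_ : _ + _ = 0) ?expR0//; ring.
  rewrite ler_pM2l ?expR_gt0//.
  exact: (mixture_ge_of_level ler01 net (lexx t) yt).
rewrite ge0_integralZl//; last 2 first.
- apply/measurable_EFinP; exact: measurable_mixture.
- by move=> y _; rewrite lee_fin mixture_ge0.
by apply: lte_mul_pinfty => //; exact: mixture_integral_fin.
Qed.

(** As the shift decreases, the sets for [T] increase and those for [id] decrease. Both limits are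
    exact, because a level set is the intersection of those at lower levels tending to its own. *)
Lemma level_diff_le (R : realType) n (K : set 'rV[R]_n)
    (T : 'rV[R]_n -> 'rV[R]_n) (r : 'rV[R]_n -> R) (pressure : (R -> R) -> Prop)
    (t : R) (u : \bar R) :
  compact K -> lipschitz1_on K T -> {within K, continuous r} ->
  (t%:E <= u)%E ->
  (forall a b, 0 < a -> (u = +oo%E -> b = +oo%E) -> pressure (capped a b)) ->
  energies_ordered K T pressure ->
  (lebesgue_rV n (level K r T t%:E `\` level K r T u) <=
   lebesgue_rV n (level K r id t%:E `\` level K r id u))%E.
Proof.
move=> compactK lipT contr tu capP Eord.
have [K0|/set0P K0] := eqVneq K set0.
  have -> : level K r T t%:E `\` level K r T u = set0.
    by apply/seteqP; split => y // -[[x]]; rewrite K0.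
  by rewrite measure0.
have lipid : lipschitz1_on K id by [].
have uNy : (-oo < u)%E by apply: lt_le_trans tu; rewrite ltNyr.
have mlevel f v : lipschitz1_on K f -> measurable (level K r f v).
  by move=> ?; exact: measurable_level.
pose d k : R := 2 * k.+1%:R^-1.
have d0 k : 0 < d k by rewrite mulr_gt0 ?invr_gt0.
have dS m k : (m <= k)%N -> d k <= d m.
  by move=> mk; rewrite /d ler_pM2l// lef_pV2 ?posrE// ler_nat.
pose F k := level K r T t%:E `\` level K r T (u - (d k)%:E).
pose G k := level K r id (t - d k)%:E `\` level K r id u.
have Fcup : \bigcup_k F k = level K r T t%:E `\` level K r T u.
  apply/seteqP; split => [y [k _ [yt yu]]|y [yt yu]].
    split => // /le_level yu'; apply/yu/yu'.
    by rewrite leeBlDr// leeDl// lee_fin ltW.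
  apply: contrapT => nF; apply: yu; apply: level_limit_seq => // k.
  by apply: contrapT => yk; apply: nF; exists k.
have Gcap : \bigcap_k G k = level K r id t%:E `\` level K r id u.
  apply/seteqP; split => [y Gy|y [yt yu] k _].
    split; last by have [] := Gy 0%N I.
    by apply: level_limit_seq => // [|k]; rewrite ?ltNyr//; have [] := Gy k I.
  split => //; apply: le_level yt; rewrite lee_fin lerBlDr lerDl ltW//.
have mF k : measurable (F k) by apply: measurableD; exact: mlevel.
have mG k : measurable (G k) by apply: measurableD; exact: mlevel.
have cF : (lebesgue_rV n \o F) x @[x --> \oo] --> lebesgue_rV n (\bigcup_k F k).
  apply: nondecreasing_cvg_mu => //; first exact: bigcupT_measurable.
  move=> m k mk; apply/subsetPset => y [yt yu]; split => // /le_level yu'.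
  by apply/yu/yu'; rewrite leeB// lee_fin dS.
(* Continuity from above needs a set of finite measure, given by [level_fin_measure]. *)
have cG : (lebesgue_rV n \o G) x @[x --> \oo] --> lebesgue_rV n (\bigcap_k G k).
  apply: nonincreasing_cvg_mu => //.
  - apply: (@le_lt_trans _ _ (lebesgue_rV n (level K r id (t - d 0%N)%:E))).
      apply: le_measure; [by apply/mem_set; exact: mG | by apply/mem_set; exact: mlevel |].
      exact: subDsetl.
    exact: level_fin_measure.
  - exact: bigcapT_measurable.
  move=> m k mk; apply/subsetPset => y [yt yu]; split => //.
  by apply: le_level yt; rewrite lee_fin lerB// dS.
rewrite -Fcup -Gcap; apply: (lee_cvg_to cF cG).
apply: nearW => k; rewrite /F /G /d /=.
by apply: (level_shrunk_le (pressure := pressure)).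
Qed.

(** * Unions of balls as level sets *)

Lemma bigcup_eball_level (R : realType) n (K : set 'rV[R]_n) (r : 'rV[R]_n -> R)
    (f : 'rV[R]_n -> 'rV[R]_n) (t : R) : (forall x, K x -> t <= r x ^+ 2) ->
  \bigcup_(x in K) eball (f x) (Num.sqrt (r x ^+ 2 - t)) = level K r f t%:E.
Proof.
(* Squaring uses [t <= r x ^+ 2]: at negative arguments [Num.sqrt] is [0], and the ball would be the
   point [f x], whose depth is below [t]. *)
move=> tr; have H x y : K x ->
    (enorm (y - f x) <= Num.sqrt (r x ^+ 2 - t)) = (t <= depth r f x y).
  move=> Kx; rewrite -[in LHS]ler_sqr ?nnegrE ?enorm_ge0 ?sqrtr_ge0//.
  by rewrite [X in _ <= X]sqr_sqrtr ?subr_ge0 ?tr// /depth; apply/idP/idP; lra.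
apply/seteqP; split => y [x Kx /= yx]; exists x => //.
  by rewrite lee_fin -H.
by rewrite /eball/= H// -lee_fin.
Qed.

Theorem theorem5p1 (R : realType) (n : nat) (K : set 'rV[R]_n)
    (T : 'rV[R]_n -> 'rV[R]_n) (r : 'rV[R]_n -> R)
    (compactK : compact K)
    (lipT : lipschitz1_on K T)
    (contr : {within K, continuous r})
    (r_gt0 : forall x, K x -> 0 < r x) :
  (energies_ordered K T nondecreasing_pressure ->
    (lebesgue_rV n (\bigcup_(x in K) eball (T x) (r x)) <=
     lebesgue_rV n (\bigcup_(x in K) eball x (r x)))%E)
  /\
  (energies_ordered K T nonnegative_pressure ->
    forall c : R, 0 < c -> c < inf [set r x ^+ 2 | x in K] ->
    (lebesgue_rV n
       ((\bigcup_(x in K) eball (T x) (Num.sqrt (r x ^+ 2 + c))) `\`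
        (\bigcup_(x in K) eball (T x) (Num.sqrt (r x ^+ 2 - c)))) <=
     lebesgue_rV n
       ((\bigcup_(x in K) eball x (Num.sqrt (r x ^+ 2 + c))) `\`
        (\bigcup_(x in K) eball x (Num.sqrt (r x ^+ 2 - c)))))%E).
Proof.
split=> [Eord|Eord c c0 cinf].
  (* The levels [0] and [+oo%E] give (i), with no cut-off in the density. *)
  have levelE f : \bigcup_(x in K) eball (f x) (r x) =
      level K r f 0%:E `\` level K r f +oo%E.
    have -> : level K r f +oo%E = set0 by apply/seteqP; split => y // [].
    rewrite setD0 -bigcup_eball_level => [|x _]; last exact: sqr_ge0.
    apply: eq_bigcupr => x Kx.
    by rewrite subr0 sqrtr_sqr gtr0_norm// r_gt0.
  rewrite levelE (levelE id).
  apply: (level_diff_le compactK lipT contr _ _ Eord); first by rewrite leey.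
  by move=> a b a0 -> //; exact: capped_nondecreasing_pressure.
have cr x : K x -> c < r x ^+ 2.
  move=> Kx; apply: (lt_le_trans cinf); apply: ge_inf; last by exists x.
  by exists 0 => _ [z _ <-]; exact: sqr_ge0.
(* Adding [c] to the squared radii lowers the level to [- c]; subtracting it raises the level to
   [c]. *)
have levelE f :
    (\bigcup_(x in K) eball (f x) (Num.sqrt (r x ^+ 2 + c))) `\`
    (\bigcup_(x in K) eball (f x) (Num.sqrt (r x ^+ 2 - c))) =
    level K r f (- c)%:E `\` level K r f c%:E.
  have crN x : K x -> - c <= r x ^+ 2.
    by move=> /cr; have := sqr_ge0 (r x); lra.
  rewrite -(bigcup_eball_level f crN) opprK -bigcup_eball_level// => x /cr.
  exact: ltW.
rewrite levelE (levelE id).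
apply: (level_diff_le compactK lipT contr _ _ Eord).
  by rewrite lee_fin (@le_trans _ _ 0) ?(ltW c0)// oppr_le0 ltW.
by move=> a b a0 _; exact: capped_nonnegative_pressure.
Qed.
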